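(* For an integer $r\ge 2$ let $f_r(z)=\sum_{n\ge 0}\binom{2n}{n}^r z^n$. Then the functions in $\{f_r : r\ge 2\}$ are algebraically independent over $\mathbb C(z)$. *)

(* Defs.v *)
From HB Require Import structures.
From mathcomp Require Import all_boot all_order all_algebra.
From mathcomp Require Import boolp reals complex.
From mathcomp Require Import mpoly.

Set Implicit Arguments.
Unset Strict Implicit.
Unset Printing Implicit Defensive.

Import GRing.Theory.
Local Open Scope ring_scope.
Local Open Scope quotient_scope.

(* R[[z]].  The series is a record rather than an alias of [nat -> R], since
   functions already carry the pointwise operations. *)
Record fps (R : Type) := Fps { fps_coef :> nat -> R }.

Lemma fpsP (R : Type) (f g : fps R) : (forall n, f n = g n) <-> f = g.
Proof.
split=> [|-> //]; case: f g => [f] [g] /= fg.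
by congr Fps; apply: funext.
Qed.

HB.instance Definition _ (R : Type) := gen_eqMixin (fps R).
HB.instance Definition _ (R : Type) := gen_choiceMixin (fps R).

Section FpsRing.
Variable R : comNzRingType.
Implicit Types f g h : fps R.

Definition fps_zero : fps R := Fps (fun=> 0).
Definition fps_one : fps R := Fps (fun n => (n == 0%N)%:R).
Definition fps_opp f : fps R := Fps (fun n => - f n).
Definition fps_add f g : fps R := Fps (fun n => f n + g n).
Definition fps_mul f g : fps R :=
  Fps (fun n => \sum_(i < n.+1) f i * g (n - i)%N).

Fact fps_addA : associative fps_add.
Proof. by move=> f g h; apply/fpsP => n /=; rewrite addrA. Qed.
Fact fps_addC : commutative fps_add.
Proof. by move=> f g; apply/fpsP => n /=; rewrite addrC. Qed.
Fact fps_add0 : left_id fps_zero fps_add.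
Proof. by move=> f; apply/fpsP => n /=; rewrite add0r. Qed.
Fact fps_addN : left_inverse fps_zero fps_opp fps_add.
Proof. by move=> f; apply/fpsP => n /=; rewrite addNr. Qed.

HB.instance Definition _ :=
  GRing.isZmodule.Build (fps R) fps_addA fps_addC fps_add0 fps_addN.

Definition fps_trunc (N : nat) f : {poly R} := \poly_(i < N) f i.

Lemma fps_mul_poly f (p q : {poly R}) g (n : nat) :
  (forall i, (i <= n)%N -> p`_i = f i) ->
  (forall i, (i <= n)%N -> q`_i = g i) ->
  (fps_mul f g) n = (p * q)`_n.
Proof.
move=> pf qg; rewrite coefM; apply: eq_bigr => i _.
by rewrite pf ?qg ?leq_subr // -ltnS.
Qed.

Lemma coef_fps_trunc N f i : (i < N)%N -> (fps_trunc N f)`_i = f i.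
Proof. by move=> iN; rewrite coef_poly iN. Qed.

Fact fps_mulC : commutative fps_mul.
Proof.
move=> f g; apply/fpsP => n.
have T k i : (i <= n)%N -> (fps_trunc n.+1 k)`_i = k i.
  by move=> le_in; rewrite coef_fps_trunc.
by rewrite (fps_mul_poly (T f) (T g)) (fps_mul_poly (T g) (T f)) mulrC.
Qed.

Fact fps_mulA : associative fps_mul.
Proof.
move=> f g h; apply/fpsP => n.
have T k i : (i <= n)%N -> (fps_trunc n.+1 k)`_i = k i.
  by move=> le_in; rewrite coef_fps_trunc.
have M k l i : (i <= n)%N ->
    (fps_trunc n.+1 k * fps_trunc n.+1 l)`_i = (fps_mul k l) i.
  move=> le_in; rewrite -(@fps_mul_poly k _ _ l) // => j le_ji;
  by apply: T; apply: leq_trans le_in.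
by rewrite (fps_mul_poly (T f) (M g h)) (fps_mul_poly (M f g) (T h)) mulrA.
Qed.

Fact fps_mul1 : left_id fps_one fps_mul.
Proof.
move=> f; apply/fpsP => n /=.
by rewrite big_ord_recl /= mul1r subn0 big1 ?addr0 // => i _; rewrite mul0r.
Qed.

Fact fps_mulDl : left_distributive fps_mul fps_add.
Proof.
move=> f g h; apply/fpsP => n /=.
by rewrite -big_split; apply: eq_bigr => i _; rewrite mulrDl.
Qed.

Fact fps_one_neq0 : fps_one != 0 :> fps R.
Proof.
by apply/eqP => /fpsP /(_ 0%N) /= /eqP; rewrite (negPf (oner_neq0 R)).
Qed.

HB.instance Definition _ := GRing.Zmodule_isComNzRing.Build (fps R)
  fps_mulA fps_mulC fps_mul1 fps_mulDl fps_one_neq0.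

Definition fps_unit : pred (fps R) := fun f => `[< exists g : fps R, g * f = 1 >].
Definition fps_inv (f : fps R) : fps R :=
  match pselect (exists g : fps R, g * f = 1) with
  | left ex => sval (cid ex)
  | right _ => f
  end.

Fact fps_mulV : {in fps_unit, left_inverse 1 fps_inv *%R}.
Proof.
move=> f /asboolP ex; rewrite /fps_inv; case: pselect => // ex'.
by case: cid.
Qed.
Fact fps_unitP (f g : fps R) : g * f = 1 -> fps_unit f.
Proof. by move=> gf; apply/asboolP; exists g. Qed.
Fact fps_inv_out : {in [predC fps_unit], fps_inv =1 id}.
Proof.
move=> f /negP nu; rewrite /fps_inv; case: pselect => // ex.
by case: nu; apply/asboolP.
Qed.

HB.instance Definition _ := GRing.ComNzRing_hasMulInverse.Build (fps R)
  fps_mulV fps_unitP fps_inv_out.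

Lemma fps_coef0 n : (0 : fps R) n = 0. Proof. by []. Qed.
Lemma fps_coef1 n : (1 : fps R) n = (n == 0%N)%:R. Proof. by []. Qed.
Lemma fps_coefN f n : (- f) n = - f n. Proof. by []. Qed.
Lemma fps_coefD f g n : (f + g) n = f n + g n. Proof. by []. Qed.
Lemma fps_coefM f g n :
  (f * g) n = \sum_(i < n.+1) f i * g (n - i)%N.
Proof. by []. Qed.

Definition fps_of_poly (p : {poly R}) : fps R := Fps (fun n => p`_n).

Fact fps_of_poly_is_zmod_morphism : zmod_morphism fps_of_poly.
Proof. by move=> p q; apply/fpsP => n /=; rewrite coefB. Qed.
Fact fps_of_poly_is_monoid_morphism : monoid_morphism fps_of_poly.
Proof.
split=> [|p q]; apply/fpsP => n /=; first by rewrite coef1.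
by rewrite coefM.
Qed.

HB.instance Definition _ := GRing.isZmodMorphism.Build {poly R} (fps R)
  fps_of_poly fps_of_poly_is_zmod_morphism.
HB.instance Definition _ := GRing.isMonoidMorphism.Build {poly R} (fps R)
  fps_of_poly fps_of_poly_is_monoid_morphism.

Lemma fps_of_poly_inj : injective fps_of_poly.
Proof. by move=> p q /fpsP pq; apply/polyP. Qed.

End FpsRing.

Fact fps_mulf_eq0 (R : idomainType) (f g : fps R) :
  f * g = 0 -> (f == 0) || (g == 0).
Proof.
move=> fg0; apply: contraT; rewrite negb_or => /andP[f0 g0].
have low (h : fps R) : h != 0 ->
    exists2 m, h m != 0 & forall i, (i < m)%N -> h i = 0.
  move=> h0; have ex : exists n, h n != 0.
    apply: contrapT => /forallNP nh; case/eqP: h0; apply/fpsP => n.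
    by apply/eqP; apply: contraT => hn; case: (nh n).
  case: (ex_minnP ex) => m hm mmin; exists m => // i im.
  by apply/eqP; apply: contraTT im => /mmin; rewrite -leqNgt.
have [a fa a_min] := low f f0; have [b gb b_min] := low g g0.
move/fpsP/(_ (a + b)%N): fg0; rewrite fps_coefM fps_coef0.
have ab : (a < (a + b).+1)%N by rewrite ltnS leq_addr.
rewrite (bigD1 (Ordinal ab)) //= addKn big1 ?addr0 => [/eqP|i neq_ia].
  by rewrite mulf_eq0 (negPf fa) (negPf gb).
have [lt_ia|gt_ia|eq_ia] := ltngtP i a.
- by rewrite a_min // mul0r.
- rewrite b_min ?mulr0 // ltn_subLR ?ltn_add2r // -ltnS; exact: ltn_ord.
- by case/eqP: neq_ia; apply: val_inj.
Qed.

HB.instance Definition _ (R : idomainType) :=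
  GRing.ComUnitRing_isIntegral.Build (fps R) (@fps_mulf_eq0 R).

(* K(z) and the field K((z)) = Frac K[[z]] containing it. *)
Notation ratfun K := {fraction {poly K}}.
Notation laurent K := {fraction (fps K)}.
Notation "x %:F" := (@FracField.tofrac _ x) : ring_scope.

Lemma frac_repr (A : idomainType) (x : {fraction A}) :
  x = (repr x).1%:F / (repr x).2%:F.
Proof.
have d0 : (repr x).2 != 0 by exact: denom_ratioP.
apply: (canRL (mulfK _)); first by rewrite tofrac_eq0.
rewrite -{1}(reprK x); unlock FracField.tofrac.
rewrite -[LHS]FracField.pi_mul; apply/eqmodP.
rewrite /= FracField.equivfE /FracField.mulf /=.
by rewrite !numden_Ratio ?(mulf_neq0, oner_neq0) ?mulr1 // mulrC.
Qed.

Section RatfunEmbedding.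
Variable K : fieldType.

(* The embedding K(z) -> K((z)); [repr x] is a pair (numerator, nonzero
   denominator) representing x, on which the value does not depend by
   [laurent_of_ratfunE]. *)
Definition laurent_of_ratfun (x : ratfun K) : laurent K :=
  (fps_of_poly (repr x).1)%:F / (fps_of_poly (repr x).2)%:F.

Let emb (p : {poly K}) : laurent K := (fps_of_poly p)%:F.

Let emb_neq0 p : p != 0 -> emb p != 0.
Proof.
move=> p0; rewrite /emb tofrac_eq0 -(rmorph0 (@fps_of_poly K)).
by rewrite (inj_eq (@fps_of_poly_inj K)).
Qed.

Let embD p q : emb (p + q) = emb p + emb q.
Proof. by rewrite /emb !rmorphD. Qed.
Let embN p : emb (- p) = - emb p.
Proof. by rewrite /emb !rmorphN. Qed.
Let embM p q : emb (p * q) = emb p * emb q.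
Proof. by rewrite /emb !rmorphM. Qed.

Lemma laurent_of_ratfunE (p q : {poly K}) : q != 0 ->
  laurent_of_ratfun (p%:F / q%:F) = (fps_of_poly p)%:F / (fps_of_poly q)%:F.
Proof.
move=> q0; rewrite /laurent_of_ratfun; set x : ratfun K := p%:F / q%:F.
have d0 : (repr x).2 != 0 by exact: denom_ratioP.
apply/eqP; rewrite eqr_div ?emb_neq0 //.
rewrite -/(emb _) -/(emb _) -/(emb _) -/(emb _) -!embM.
have /eqP : p%:F / q%:F = (repr x).1%:F / (repr x).2%:F by exact: frac_repr x.
rewrite eqr_div ?tofrac_eq0 // -!rmorphM /= tofrac_eq => /eqP pq.
by rewrite -pq.
Qed.

Let fracE (x : ratfun K) : exists p q, q != 0 /\ x = p%:F / q%:F.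
Proof.
exists (repr x).1, (repr x).2; split; last exact: frac_repr.
exact: denom_ratioP.
Qed.

Fact laurent_of_ratfun_is_zmod_morphism : zmod_morphism laurent_of_ratfun.
Proof.
move=> x y; have [p [q [q0 ->]]] := fracE x; have [r [s [s0 ->]]] := fracE y.
rewrite -mulNr addf_div ?tofrac_eq0 // -tofracN -!tofracM -tofracD.
rewrite !laurent_of_ratfunE ?mulf_neq0 // -!/(emb _) embD !embM embN.
by rewrite -[RHS]/(_ + - (_ / _)) -mulNr addf_div ?emb_neq0.
Qed.

Fact laurent_of_ratfun_is_monoid_morphism : monoid_morphism laurent_of_ratfun.
Proof.
split=> [|x y].
  rewrite -[1 in LHS](divr1 1) -tofrac1 laurent_of_ratfunE ?oner_neq0 //.
  by rewrite rmorph1 tofrac1 divr1.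
have [p [q [q0 ->]]] := fracE x; have [r [s [s0 ->]]] := fracE y.
rewrite mulf_div -!tofracM !laurent_of_ratfunE ?mulf_neq0 // -!/(emb _) !embM.
by rewrite mulf_div.
Qed.

HB.instance Definition _ := GRing.isZmodMorphism.Build (ratfun K) (laurent K)
  laurent_of_ratfun laurent_of_ratfun_is_zmod_morphism.
HB.instance Definition _ := GRing.isMonoidMorphism.Build (ratfun K) (laurent K)
  laurent_of_ratfun laurent_of_ratfun_is_monoid_morphism.

End RatfunEmbedding.

(* The family (x i)_(i : I) of elements of L is algebraically independent over
   K, where L is a field extension of K via iota. *)
Definition alg_independent (K L : fieldType) (iota : {rmorphism K -> L})
    (I : Type) (x : I -> L) : Prop :=
  forall (n : nat) (i : 'I_n -> I), injective i ->
  forall P : {mpoly K[n]}, mmap iota (fun k => x (i k)) P = 0 -> P = 0.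

(* f_r, identified with its power series at 0: Taylor expansion embeds the germs
   at 0 of meromorphic functions into K((z)). *)
Definition central_binomial_series (K : fieldType) (r : nat) : fps K :=
  Fps (fun n => ('C(n.*2, n) ^ r)%N%:R).

(* Main.v *)
Require Import Defs.
From HB Require Import structures.
From mathcomp Require Import all_boot all_order all_algebra all_field.
From mathcomp Require Import boolp reals complex.
From mathcomp Require Import mpoly.
From mathcomp Require Import ring zify.

Set Implicit Arguments.
Unset Strict Implicit.
Unset Printing Implicit Defensive.

Import Order.TTheory GRing.Theory Num.Theory.
Local Open Scope ring_scope.
Local Open Scope complex_scope.

(* Write u_n for the central binomial coefficients.  A relation between the
   monomials F_m = prod f_r^(m_r) over C(z) yields one over Z[z], since the
   F_m have integer coefficients, hence a nonzero one over K[z], where K is an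
   algebraic closure of F_p and p a large prime.  By Lucas' theorem
   f_r = A_r f_r^p in K[[z]], with A_r the truncation of f_r at degree
   (p - 1) / 2, so that every F_m is a (p - 1)-st root of 1 / B_m with
   B_m = prod A_r^(m_r), and Artin's argument for the shortest relation provides
   m <> m' for which B_m / B_m' is a (p - 1)-st power in K(z).  But A_r still
   satisfies the hypergeometric equation theta^r A = 2^r z (2 theta + 1)^r A,
   which bounds the multiplicities of its roots independently of p.  Hence
   B_m = B_m', and F_m and F_m' agree modulo p up to degree p - 1.  For p large
   this forces F_m = F_m' over Z, which is impossible: after cancelling common
   factors, the largest r occurs on one side only, and u_n^r grows like 4^(rn)
   up to a polynomial factor, faster than the other side. *)

(** * Linear dependence *)

(** Fraction-free elimination on the unknowns [s]: a nonzero coefficient [v a n] is the pivot that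
    removes [a] from all equations; if there is none, [a] is free. The equations, one for each n,
    are infinite in number. *)
Lemma lin_dep_descent (D L : idomainType) (phi : {rmorphism D -> L})
    (I : eqType) (s : seq I) (v : I -> nat -> D) (c : I -> L) :
  injective phi -> uniq s -> (exists2 i, i \in s & c i != 0) ->
  (forall n, \sum_(i <- s) c i * phi (v i n) = 0) ->
  exists2 d : I -> D, (exists2 i, i \in s & d i != 0) &
    forall n, \sum_(i <- s) d i * v i n = 0.
Proof.
move=> phi_inj; elim: s v => [|a s IHs] v /=; first by move=> _ [].
case/andP=> as_ us [i0 i0s ci0] cv.
have neq_a i : i \in s -> (i == a) = false.
  by move=> is_; apply: contraNF as_ => /eqP <-.
have [/forallNP va0|/existsNP[n /contrapT van]] := pselect (forall n, ~ v a n != 0).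
  exists (fun i => (i == a)%:R); first by exists a; rewrite ?mem_head ?eqxx ?oner_neq0.
  move=> n; rewrite big_cons eqxx mul1r.
  have -> : v a n = 0 by apply/eqP; apply: contraT => van; case: va0; exists n.
  by rewrite add0r big_seq big1 // => i /neq_a ->; rewrite mul0r.
have phi_van : phi (v a n) != 0.
  by rewrite -(rmorph0 phi) (inj_eq phi_inj).
have cvE k : \sum_(i <- s) c i * phi (v i k) = - (c a * phi (v a k)).
  by apply/eqP; rewrite -addr_eq0 addrC; move: (cv k); rewrite big_cons => ->.
have [|k|d [i1 i1s di1] dv] := IHs (fun i k => v a n * v i k - v i n * v a k) us.
- apply: contrapT => nc.
  have c0 i : i \in s -> c i = 0.
    by move=> is_; apply/eqP; apply: contraT => ci; case: nc; exists i.
  move: (cvE n); rewrite big_seq big1; last by move=> i /c0 ->; rewrite mul0r.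
  move/esym/eqP; rewrite oppr_eq0 mulf_eq0 (negPf phi_van) orbF => /eqP ca0.
  by move: i0s ci0; rewrite inE => /orP[/eqP->|/c0->]; rewrite ?ca0 eqxx.
- under eq_bigr do rewrite rmorphB !rmorphM mulrBr mulrCA [c _ * (_ * _)]mulrA.
  by rewrite sumrB -mulr_sumr -mulr_suml !cvE mulrN mulNr opprK; ring.
(* Back-substitution: the value at [a] is read off equation n, the other values being scaled by the
   pivot. *)
exists (fun i => if i == a then - \sum_(j <- s) d j * v j n else v a n * d i).
  by exists i1; rewrite ?neq_a ?mulf_neq0 // inE i1s orbT.
move=> k; rewrite big_cons eqxx -[RHS](dv k) mulNr mulr_suml.
rewrite -sumrN -big_split /= [LHS]big_seq [RHS]big_seq; apply: eq_bigr => i is_.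
by rewrite neq_a //; ring.
Qed.

(* Artin's argument: of the two relations obtained by raising to the p-th power
   and by substituting y = b y^p, the shortest relation allows only
   proportional ones. *)
Lemma frobenius_dependence (D L : idomainType) (phi : {rmorphism D -> L})
    (p : nat) (I : finType) (y : I -> L) (b c : I -> D) :
  injective phi -> p \in [pchar L] ->
  (forall i, y i = phi (b i) * y i ^+ p) -> (forall i, y i != 0) ->
  (exists i, c i != 0) -> \sum_i phi (c i) * y i = 0 ->
  exists i j, exists c1 c2 : D, [/\ i != j, c1 != 0, c2 != 0 &
    c1 ^+ p.-1 * b i = c2 ^+ p.-1 * b j].
Proof.
move=> phi_inj charp yb y0.
have p_gt0 : (0 < p)%N by rewrite prime_gt0 // (pcharf_prime charp).
have b0 i : b i != 0.
  by apply: contraNneq (y0 i) => bi0; rewrite yb bi0 rmorph0 mul0r.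
have [k] := ubnP #|[pred i | c i != 0]|; elim: k c => // k IHk c.
rewrite ltnS => ck [i ci] cy.
have [j /andP[ij cj]] : exists j, (j != i) && (c j != 0).
  apply: contrapT => /forallNP ni.
  move: cy; rewrite (bigD1 i) //= big1 ?addr0 => [/eqP|j ji].
    by rewrite mulf_eq0 (negPf (y0 i)) orbF -(rmorph0 phi) (inj_eq phi_inj) (negPf ci).
  by have := ni j; rewrite ji /= => /negP; rewrite negbK => /eqP ->; rewrite rmorph0 mul0r.
have powE (u v : I) : c u * b u * c v ^+ p - c u ^+ p * (c v * b v) =
    (c u * c v) * (c v ^+ p.-1 * b u - c u ^+ p.-1 * b v).
  by rewrite -{1 2}(prednK p_gt0) !exprS; ring.
have [e0|e0] := eqVneq (c i * b i * c j ^+ p - c i ^+ p * (c j * b j)) 0.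
  exists i, j, (c j), (c i); split=> //; first by rewrite eq_sym.
  move/eqP: e0; rewrite powE !mulf_eq0 (negPf ci) (negPf cj) /= subr_eq0.
  by move/eqP.
(* Both relations are relations between the [y u ^+ p]; [e] is the combination of them in which [i]
   cancels. *)
pose e u := c i * b i * c u ^+ p - c i ^+ p * (c u * b u).
have ey : \sum_u phi (e u) * y u ^+ p = 0.
  under eq_bigr do rewrite /e rmorphB mulrBl !rmorphM -!mulrA.
  rewrite sumrB -!mulr_sumr.
  have -> : \sum_u phi (c u ^+ p) * y u ^+ p = 0.
    move/(congr1 (pFrobenius_aut charp)): cy; rewrite rmorph0 rmorph_sum /=.
    move=> cy; rewrite -[RHS]cy; apply: eq_bigr => u _.
    by rewrite pFrobenius_autE exprMn rmorphXn.
  under eq_bigr do rewrite -yb.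
  by rewrite cy !mulr0 subr0.
(* Multiplication by all the [b w] turns each [y u ^+ p] back into [y u] without any division. *)
apply: (IHk (fun u => e u * \prod_(w | w != u) b w)).
- apply: leq_trans ck; apply: proper_card; apply/properP; split.
    apply/subsetP => u; rewrite !inE; apply: contraNneq => cu.
    by rewrite /e cu expr0n /= gtn_eqF // mul0r !mulr0 subrr mul0r.
  by exists i; rewrite !inE // negbK /e powE subrr mulr0 mul0r.
- exists j; rewrite mulf_neq0 //; apply/prodf_neq0 => w _; exact: b0.
- transitivity (phi (\prod_w b w) * \sum_u phi (e u) * y u ^+ p); last by rewrite ey mulr0.
  rewrite mulr_sumr; apply: eq_bigr => u _.
  by rewrite [in LHS]yb [in RHS](bigD1 u) //= !rmorphM /=; ring.
Qed.

(** * Root multiplicities from the hypergeometric equation *)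

(** The Euler operator z d/dz. *)
Definition theta (K : comNzRingType) (q : {poly K}) : {poly K} := 'X * q^`().

Lemma coef_iter_theta (K : comNzRingType) (q : {poly K}) i n :
  (iter i (@theta K) q)`_n = n%:R ^+ i * q`_n.
Proof.
elim: i => [|i IHi] /=; first by rewrite expr0 mul1r.
rewrite /theta coefXM coef_deriv; case: n IHi => [|n] IHi /=; last first.
  by rewrite IHi exprS -[LHS]mulr_natl mulrA.
by rewrite expr0n mul0r.
Qed.

Lemma natr_neq0_pchar (K : nzRingType) (p n : nat) :
  p \in [pchar K] -> (0 < n < p)%N -> n%:R != 0 :> K.
Proof.
move=> charp /andP[n0 np]; rewrite -(dvdn_pcharf charp).
by rewrite gtnNdvd.
Qed.

(** With t = 'X - a, [theta] maps h t^k to 'X (k h + t h') t^(k-1); the recursion follows the factor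
    in front of the power of t, starting from g t^m. *)
Fixpoint theta_cofactor (K : comNzRingType) (a : K) (m : nat) (g : {poly K})
    (i : nat) : {poly K} :=
  if i is j.+1 then
    let h := theta_cofactor a m g j in
    'X * ((m - j)%:R * h + ('X - a%:P) * h^`())
  else g.

Lemma iter_theta_mul_XsubC (K : comNzRingType) (a : K) (m : nat)
    (g : {poly K}) (i : nat) : (i <= m)%N ->
  iter i (@theta K) (g * ('X - a%:P) ^+ m) =
  theta_cofactor a m g i * ('X - a%:P) ^+ (m - i).
Proof.
elim: i => [|i IHi] im /=; first by rewrite subn0.
rewrite IHi 1?ltnW // /theta -(subnSK im); set h := theta_cofactor _ _ _ _.
rewrite derivM deriv_exp derivXsubC mul1r -mulr_natl exprS /=.
by ring.
Qed.

(* At a root a of multiplicity m >= r, each iterate theta^i A with i <= r has a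
   zero of order exactly m - i.  Comparing the lowest order terms of the equation
   at a yields 4^r a = 1, and the next ones yield 2 (m + 1) = r in K, which is
   absurd since 0 < 2 m + 2 - r < p. *)
Lemma hypergeometric_root_mult (K : fieldType) (p r : nat) (A : {poly K}) (a : K) :
  p \in [pchar K] -> (2 <= r)%N -> (2 * size A <= p.+1)%N -> A.[0] != 0 ->
  iter r (@theta K) A =
    (2 ^+ r)%:P * 'X * \sum_(i < r.+1) ('C(r, i)%:R * 2 ^+ i)%:P * iter i (@theta K) A ->
  (mup a A < r)%N.
Proof.
case: r => [|[|s]] // charp _ szA A0 ode.
have Anz : A != 0 by apply: contraNneq A0 => ->; rewrite horner0.
have [m [g]] := multiplicity_XsubC A a; rewrite Anz /= => ga AE.
set t := 'X - a%:P in AE.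
have gnz : g != 0 by apply: contraNneq ga => ->; rewrite root0.
have -> : mup a A = m.
  by rewrite AE mupMr // /t mup_XsubCX eqxx.
rewrite ltnNge; apply/negP => sm.
have szt : size A = (size g + m)%N.
  by rewrite AE size_Mmonic ?monic_exp ?monicXsubC // size_exp_XsubC addnS.
(* The bound on [size A] keeps the integers met below, such as [m - i] and [2 * m - s], from
   vanishing in [K]. *)
have mp : (2 * m < p)%N by move: gnz szA; rewrite szt -size_poly_gt0; lia.
have p0 : prime p := pcharf_prime charp.
have a0 : a != 0.
  apply: contraNneq A0 => a0; rewrite AE /t a0 subr0 hornerM horner_exp hornerX.
  by rewrite expr0n /=; case: (m) sm => // k _; rewrite mulr0.
pose G := theta_cofactor a m g.
have GS i : G i.+1 = 'X * ((m - i)%:R * G i + t * (G i)^`()) by [].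
have GSa i : (G i.+1).[a] = a * (m - i)%:R * (G i).[a].
  rewrite GS /t !hornerE /= subrr mul0r addr0 mulrA; congr (_ * _ * _).
  by rewrite -polyC_natr hornerC.
have Ga i : (i <= m)%N -> (G i).[a] != 0.
  elim: i => [|i IHi] im; first by rewrite -rootE.
  rewrite GSa !mulf_neq0 ?IHi 1?ltnW //.
  by apply: (natr_neq0_pchar charp); rewrite subn_gt0 im /=; lia.
have iterE i : (i <= m)%N -> iter i (@theta K) A = G i * t ^+ (m - i).
  by rewrite AE; exact: iter_theta_mul_XsubC.
clearbody G.
(* The terms of index at most s, divided by t^(m - s). In the equation divided by t^(m - r) they
   carry t^2 and do not affect the two lowest orders at a. *)
pose h := \sum_(i < s.+1) ('C(s.+2, i)%:R * 2 ^+ i)%:P * (G i * t ^+ (s - i)).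
have tnz : t != 0 by rewrite polyXsubC_eq0.
have big2 (F : nat -> {poly K}) :
    \sum_(i < s.+3) F i = \sum_(i < s.+1) F i + F s.+1 + F s.+2.
  by rewrite 2!big_ord_recr.
have E1 : G s.+2 = (2 ^+ s.+2)%:P * 'X * (h * t ^+ 2 +
    (s.+2%:R * 2 ^+ s.+1)%:P * (G s.+1 * t) + (2 ^+ s.+2)%:P * G s.+2).
  apply: (mulIf (expf_neq0 (m - s.+2) tnz)).
  rewrite -iterE // ode -[RHS]mulrA; congr (_ * _).
  have -> : \sum_(i < s.+3) ('C(s.+2, i)%:R * 2 ^+ i)%:P * iter i (@theta K) A =
      \sum_(i < s.+3) ('C(s.+2, i)%:R * 2 ^+ i)%:P * (G i * t ^+ (m - i)).
    apply: eq_bigr => i _; rewrite iterE //; apply: leq_trans sm.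
    by rewrite -ltnS.
  rewrite (big2 (fun i => ('C(s.+2, i)%:R * 2 ^+ i)%:P * (G i * t ^+ (m - i)))).
  rewrite binn binSn [1%:R * _]mul1r !mulrDl; congr (_ + _ + _).
  - rewrite /h !mulr_suml; apply: eq_bigr => i _.
    have -> : (m - i = (s - i) + 2 + (m - s.+2))%N by case: i => i /=; lia.
    by rewrite !exprD !mulrA.
  - have -> : (m - s.+1 = 1 + (m - s.+2))%N by lia.
    by rewrite exprD expr1 !mulrA.
  - exact: mulrA.
have two0 : 2 != 0 :> K by apply: (natr_neq0_pchar charp); lia.
have w0 : 2 ^+ s.+2 != 0 :> K by rewrite expf_neq0.
have kw : 2 * (s.+2%:R * 2 ^+ s.+1) = s.+2%:R * 2 ^+ s.+2 :> K.
  by rewrite mulrCA -exprS.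
(* For [ring], the constants become variables: w for 2^r and k for r 2^(r-1), linked by 2 k = r
   w. *)
move: (2 ^+ s.+2 : K) (s.+2%:R * 2 ^+ s.+1 : K) E1 w0 kw => w k E1 w0 kw.
have E1' : G s.+2 * (1 - (w * w)%:P * 'X) = w%:P * 'X * t * (h * t + k%:P * G s.+1).
  by rewrite mulrBr mulr1 {1}E1 polyCM; ring.
have wa : w * w * a = 1.
  move: (congr1 (horner^~ a) E1'); rewrite /t !hornerE subrr mulr0 mul0r.
  by move/eqP; rewrite mulf_eq0 (negPf (Ga _ sm)) subr_eq0 => /eqP <-.
(* As w^2 a = 1, the factor 1 - w^2 'X is -w^2 t, and one t cancels. *)
have E2 : - (w * w)%:P * G s.+2 =
   w%:P * 'X * (h * t + k%:P * G s.+1).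
  apply: (mulIf tnz); rewrite mulrAC -[RHS]mulrAC -E1' -[1]/(1%:P) -wa.
  by rewrite /t !polyCM; ring.
move: (congr1 (horner^~ a) E2).
rewrite /t !hornerE subrr mulr0 add0r GSa => E3.
have: (2 * (m - s.+1)%:R + s.+2%:R) * (w * w * a * (G s.+1).[a]) = 0.
  transitivity (2 * (w * a * (k * (G s.+1).[a])
     - - (w * w) * (a * (m - s.+1)%:R * (G s.+1).[a]))); last by rewrite E3 subrr mulr0.
  by ring: kw.
rewrite wa mul1r => /eqP; rewrite mulf_eq0 (negPf (Ga _ (ltnW sm))) orbF.
rewrite -natrM -natrD; apply/negP; apply: (natr_neq0_pchar charp).
by lia.
Qed.

(** * Central binomial coefficients modulo p *)

Lemma coef_X1_exp (R : nzSemiRingType) (n k : nat) :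
  (('X + 1 : {poly R}) ^+ n)`_k = 'C(n, k)%:R.
Proof.
rewrite exprD1n coef_sum.
under eq_bigr => i _ do rewrite coefMn coefXn.
have [kn|nk] := ltnP k n.+1.
  rewrite (bigD1 (Ordinal kn)) //= eqxx big1 ?addr0 // => i neq_ik.
  by rewrite eq_sym (_ : (i == k :> nat) = false) ?mul0rn //; apply/negbTE.
rewrite bin_small // big1 // => i _.
by rewrite gtn_eqF ?mul0rn // (leq_trans (ltn_ord i)).
Qed.

(** Since ('X + 1)^p = 'X^p + 1, passing from a to a + 1 amounts to Pascal's rule in (a, c). *)
Lemma lucas (R : comNzRingType) (p a b c d : nat) :
  p \in [pchar R] -> (b < p)%N -> (d < p)%N ->
  'C((p * a + b)%N, (p * c + d)%N)%:R = ('C(a, c) * 'C(b, d))%N%:R :> R.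
Proof.
move=> charp bp dp; have charP : p \in [pchar {poly R}] by rewrite pchar_poly.
have p0 : (0 < p)%N by case: (p) bp.
have X1p : ('X + 1 : {poly R}) ^+ p = 'X^p + 1.
  by rewrite -pFrobenius_autE rmorphD rmorph1 /= pFrobenius_autE.
elim: a c => [|a IHa] c.
  rewrite muln0 add0n; case: c => [|c]; first by rewrite muln0 bin0 mul1n.
  by rewrite bin_small ?bin0n //; nia.
rewrite -coef_X1_exp mulnS -addnA exprD X1p mulrDl mul1r coefD coefXnM !coef_X1_exp.
rewrite IHa; case: c => [|c].
  by rewrite muln0 dp add0r !bin0.
rewrite mulnS -addnA ltnNge leq_addr addKn /= IHa binS mulnDl natrD addrC.
by [].
Qed.

Definition cbin (n : nat) : nat := 'C(n.*2, n).

Lemma cbinS n : (n.+1 * cbin n.+1 = 2 * (n.*2.+1 * cbin n))%N.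
Proof.
rewrite /cbin doubleS.
have e1 := mul_bin_diag n.*2.+2 n; have e2 := mul_bin_down n.*2.+1 n.
rewrite /= in e1 e2; rewrite (_ : n.*2.+1 - n = n.+1)%N in e2; last by lia.
by rewrite -e1 e2 mulnA mul2n doubleS.
Qed.

(** A last digit b <= h doubles without carry, and Lucas splits off u_b. Otherwise the last digit of
    2n is 2b - p < b, and its binomial factor vanishes. *)
Lemma cbin_lucas (R : comNzRingType) (h n : nat) :
  let p := h.*2.+1 in p \in [pchar R] ->
  (cbin n)%:R = (cbin (n %/ p) * (if n %% p <= h then cbin (n %% p) else 0))%N%:R :> R.
Proof.
move=> p charp; rewrite {1}/cbin; set a := (n %/ p)%N; set b := (n %% p)%N.
have bp : (b < p)%N by rewrite ltn_mod.
have -> : n = (p * a + b)%N by rewrite /a /b mulnC -divn_eq.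
case: ifP => [bh|/negbT]; last rewrite -ltnNge => bh.
  have -> : (p * a + b).*2 = (p * a.*2 + b.*2)%N by lia.
  by rewrite (lucas _ _ charp) // /p; lia.
have -> : (p * a + b).*2 = (p * a.*2.+1 + (b.*2 - p))%N by rewrite /p in bh *; lia.
rewrite (lucas _ _ charp) //; last by lia.
by rewrite ['C(b.*2 - p, b)]bin_small ?muln0 //; lia.
Qed.

(** * Frobenius on power series and the identity f_r = A_r f_r^p *)

Lemma fps_coef_exp_trunc (R : comNzRingType) (f : fps R) N k i : (i < N)%N ->
  (f ^+ k) i = (fps_trunc N f ^+ k)`_i.
Proof.
elim: k i => [|k IHk] i iN; first by rewrite !expr0 coef1.
rewrite !exprS; apply: fps_mul_poly => j ji.
  by rewrite coef_fps_trunc // (leq_ltn_trans ji).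
by rewrite IHk // (leq_ltn_trans ji).
Qed.

Lemma fps_coef_exp_pchar (R : comNzRingType) (p : nat) (f : fps R) n :
  p \in [pchar R] ->
  (f ^+ p) n = if (p %| n)%N then f (n %/ p)%N ^+ p else 0.
Proof.
move=> charp; have charP : p \in [pchar {poly R}] by rewrite pchar_poly.
have p0 : (0 < p)%N by rewrite prime_gt0 // (pcharf_prime charp).
rewrite (fps_coef_exp_trunc _ _ (ltnSn n)) -(pFrobenius_autE charP).
rewrite /fps_trunc poly_def rmorph_sum coef_sum /=.
under eq_bigr => i _ do rewrite pFrobenius_autE exprZn -exprM coefZ coefXn.
case: ifP => [/dvdnP[m ->]|ndvd].
  rewrite mulnK //.
  have mn : (m < (m * p).+1)%N by rewrite ltnS leq_pmulr.
  rewrite (bigD1 (Ordinal mn)) //= eqxx mulr1 big1 ?addr0 // => i im.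
  by rewrite eqn_pmul2r // eq_sym (_ : (i == m :> nat) = false) ?mulr0 //; apply/negbTE.
rewrite big1 // => i _; case: eqP => [ni|]; last by rewrite mulr0.
have dv : (p %| n)%N by rewrite ni dvdn_mull.
by rewrite dv in ndvd.
Qed.

(** The series f_r over any commutative ring, Z included, so that it can be reduced modulo p. *)
Definition cbseries (R : comNzRingType) (r : nat) : fps R :=
  Fps (fun n => (cbin n ^ r)%N%:R).

Definition cbtrunc (R : comNzRingType) (h r : nat) : {poly R} :=
  \poly_(n < h.+1) (cbin n ^ r)%N%:R.

(** For n = p a + b with b < p, the only contribution to z^n comes from z^b in A_r and z^(p a) in
    f_r^p; [cbin_lucas] identifies it with u_n^r. *)
Lemma cbseries_frobenius (R : comNzRingType) (h r : nat) :
  let p := h.*2.+1 in p \in [pchar R] -> (0 < r)%N ->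
  cbseries R r = fps_of_poly (cbtrunc R h r) * cbseries R r ^+ p.
Proof.
move=> p charp r0; apply/fpsP => n; rewrite fps_coefM /=.
have p0 : (0 < p)%N by [].
have hp : (h < p)%N by rewrite /p; lia.
under eq_bigr => i _ do rewrite fps_coef_exp_pchar // coef_poly ltnS /=.
rewrite natrX (cbin_lucas n charp) -natrX expnMn.
have mn : (n %% p < n.+1)%N by rewrite ltnS leq_mod.
rewrite (bigD1 (Ordinal mn)) //= big1 ?addr0 => [|i /eqP im].
  have -> : (n - n %% p = n %/ p * p)%N by rewrite {1}(divn_eq n p) addnK.
  rewrite dvdn_mull // mulnK //.
  (* Fermat: the image of an integer is its own p-th power. *)
  rewrite -pFrobenius_autE pFrobenius_aut_nat.
  by case: ifP => _; rewrite ?exp0n // ?muln0 ?mul0r // mulnC natrM.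
case: ifP => ih; last by rewrite mul0r.
case: ifP => [dv|]; last by rewrite mulr0.
case: im; apply: val_inj => /=; have lein : (i <= n)%N by rewrite -ltnS.
by rewrite -[in RHS](subnK lein) -modnDml (eqP dv) add0n modn_small // (leq_ltn_trans ih).
Qed.

(** The sum expands (2 theta + 1)^r. Below the cut, the coefficients satisfy the r-th power of
    [cbinS]; at the cut the factor 2h + 1 = p is zero in [R], so the truncation does no harm. *)
Lemma cbtrunc_ode (R : comNzRingType) (h r : nat) :
  h.*2.+1 \in [pchar R] -> (0 < r)%N ->
  iter r (@theta R) (cbtrunc R h r) =
    (2 ^+ r)%:P * 'X * \sum_(i < r.+1)
      ('C(r, i)%:R * 2 ^+ i)%:P * iter i (@theta R) (cbtrunc R h r).
Proof.
move=> charp r0; apply/polyP => n; rewrite coef_iter_theta -mulrA coefCM coefXM.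
case: n => [|n] /=; first by rewrite expr0n gtn_eqF // mul0r mulr0.
rewrite coef_sum; under eq_bigr => i _ do rewrite coefCM coef_iter_theta.
have -> : \sum_(i < r.+1) 'C(r, i)%:R * 2 ^+ i * (n%:R ^+ i * (cbtrunc R h r)`_n) =
    (n.*2.+1)%:R ^+ r * (cbtrunc R h r)`_n :> R.
  rewrite -[n.*2.+1]addn1 -mul2n natrD natrM exprD1n mulr_suml; apply: eq_bigr => i _.
  by rewrite -[X in _ = X * _]mulr_natl exprMn !mulrA.
rewrite !coef_poly !ltnS.
have [nh|hn|->] := ltngtP n h.
- by rewrite /= -!natrX -!natrM -!expnMn cbinS !natrX.
- by rewrite !mulr0.
by rewrite mulr0 (pcharf0 charp) ?expr0n ?gtn_eqF // mul0r mulr0.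
Qed.

Lemma fps_coef0M (R : comNzRingType) (f g : fps R) : (f * g) 0%N = f 0%N * g 0%N.
Proof. by rewrite fps_coefM big_ord1. Qed.

Definition cbmono (R : comNzRingType) (n : nat) (r m : 'I_n -> nat) : fps R :=
  \prod_k cbseries R (r k) ^+ m k.

(** B_m is a product of truncations, not a truncation of the product. *)
Definition cbmono_trunc (R : comNzRingType) (h n : nat) (r m : 'I_n -> nat) : {poly R} :=
  \prod_k cbtrunc R h (r k) ^+ m k.

Lemma cbmono_coef0 (R : comNzRingType) n (r m : 'I_n -> nat) : cbmono R r m 0%N = 1.
Proof.
rewrite /cbmono; elim/big_rec: _ => [//|k f _ f0].
rewrite fps_coef0M f0 mulr1; elim: (m k) => [//|i IHi].
by rewrite exprS fps_coef0M IHi mulr1 /= /cbin double0 bin0 exp1n.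
Qed.

Lemma cbmono_neq0 (R : comNzRingType) n (r m : 'I_n -> nat) : cbmono R r m != 0.
Proof.
by apply/eqP => /fpsP/(_ 0%N)/eqP; rewrite cbmono_coef0 fps_coef0 oner_eq0.
Qed.

Lemma cbmono_frobenius (R : comNzRingType) h n (r m : 'I_n -> nat) :
  let p := h.*2.+1 in p \in [pchar R] -> (forall k, 0 < r k)%N ->
  cbmono R r m = fps_of_poly (cbmono_trunc R h r m) * cbmono R r m ^+ p.
Proof.
move=> p charp r0; rewrite /cbmono /cbmono_trunc rmorph_prod -prodrXl -big_split /=.
apply: eq_bigr => k _; rewrite {1}(cbseries_frobenius charp (r0 k)) exprMn -rmorphXn.
by rewrite -!exprM mulnC.
Qed.

(** In F_m = B_m F_m^p, the factor F_m^p has constant term 1 and no other term below degree p. *)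
Lemma cbmono_coef_trunc (R : comNzRingType) h n (r m : 'I_n -> nat) i :
  let p := h.*2.+1 in p \in [pchar R] -> (forall k, 0 < r k)%N -> (i < p)%N ->
  cbmono R r m i = (cbmono_trunc R h r m)`_i.
Proof.
move=> p charp r0 ip; rewrite (cbmono_frobenius m charp r0) fps_coefM big_ord_recr /=.
rewrite subnn fps_coef_exp_pchar // dvdn0 div0n cbmono_coef0 expr1n mulr1.
rewrite big1 ?add0r // => j _; rewrite fps_coef_exp_pchar // gtnNdvd ?mulr0 //.
  by rewrite subn_gt0.
by rewrite (leq_ltn_trans (leq_subr _ _)).
Qed.

(* After division by the gcd of c1 and c2, a root of c1 would be a root of B2 of
   multiplicity at least q, and symmetrically. *)
Lemma eq_of_small_mup (K : closedFieldType) (q : nat) (c1 c2 B1 B2 : {poly K}) :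
  c1 != 0 -> c2 != 0 -> B1.[0] = 1 -> B2.[0] = 1 ->
  (forall a, (mup a B1 < q)%N) -> (forall a, (mup a B2 < q)%N) ->
  c1 ^+ q * B1 = c2 ^+ q * B2 -> B1 = B2.
Proof.
move=> c1nz c2nz B1z B2z mB1 mB2 E.
have B_neq0 (B : {poly K}) : B.[0] = 1 -> B != 0.
  by move=> B0; apply: contra_eq_neq B0 => ->; rewrite horner0 eq_sym oner_neq0.
have gnz : gcdp c1 c2 != 0 by rewrite gcdp_eq0 negb_and c1nz.
have [d1 d1E] : exists d1, c1 = d1 * gcdp c1 c2.
  by exists (c1 %/ gcdp c1 c2); rewrite divpK // dvdp_gcdl.
have [d2 d2E] : exists d2, c2 = d2 * gcdp c1 c2.
  by exists (c2 %/ gcdp c1 c2); rewrite divpK // dvdp_gcdr.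
have cop : coprimep d1 d2.
  have -> : d1 = c1 %/ gcdp c1 c2 by rewrite {1}d1E mulpK.
  have -> : d2 = c2 %/ gcdp c1 c2 by rewrite {1}d2E mulpK.
  by apply: coprimep_div_gcd; rewrite c1nz.
have Ed : d1 ^+ q * B1 = d2 ^+ q * B2.
  apply: (mulIf (expf_neq0 q gnz)); rewrite mulrAC [RHS]mulrAC.
  by rewrite -!exprMn -d1E -d2E.
have const (d d' B B' : {poly K}) : d != 0 -> coprimep d d' -> B'.[0] = 1 ->
    (forall a, (mup a B' < q)%N) -> d ^+ q * B = d' ^+ q * B' ->
    exists2 u, u != 0 & d = u%:P.
  move=> dnz cdd B'0 mB' dB; have [sd1|sd1] := eqVneq (size d) 1%N.
    by move/eqP: sd1 => /size_poly1P[u u0 ->]; exists u.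
  have /closed_rootP[a ra] := sd1.
  have := mB' a; rewrite (mup_ltn _ _ (B_neq0 _ B'0)) => /negP[].
  apply: dvdp_trans (_ : d ^+ q %| _); first by rewrite dvdp_exp2r // dvdp_XsubCl.
  rewrite -(Gauss_dvdpr B' (_ : coprimep _ (d' ^+ q))) -?dB ?dvdp_mulr //.
  by rewrite coprimep_expl ?coprimep_expr.
have d1nz : d1 != 0 by apply: contraNneq c1nz => d0; rewrite d1E d0 mul0r.
have d2nz : d2 != 0 by apply: contraNneq c2nz => d0; rewrite d2E d0 mul0r.
have [u u0 uE] := const _ _ _ _ d1nz cop B2z mB2 Ed.
have [|v v0 vE] := const _ _ _ _ d2nz _ B1z mB1 (esym Ed); first by rewrite coprimep_sym.
move: Ed; rewrite uE vE => Ed.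
(* [B1] and [B2] now differ by a constant factor, which their values at 0 show to be 1. *)
have uv : u ^+ q = v ^+ q.
  by move/(congr1 (horner^~ 0)): Ed; rewrite !hornerM B1z B2z !mulr1 !horner_exp !hornerC.
move: Ed; rewrite -!polyC_exp uv; apply: mulfI.
by rewrite /= polyC_eq0 expf_neq0.
Qed.

Lemma mup_prod_exp (K : fieldType) (I : finType) (B : I -> {poly K}) (m : I -> nat) a :
  (forall i, B i != 0) -> mup a (\prod_i B i ^+ m i) = (\sum_i m i * mup a (B i))%N.
Proof.
move=> Bnz; have mup1 : mup a (1 : {poly K}) = 0%N by rewrite mupNroot ?root1.
have Xnz i k : B i ^+ k != 0 by rewrite expf_neq0.
have mupX i k : mup a (B i ^+ k) = (k * mup a (B i))%N.
  by elim: k => [|k IHk]; rewrite ?expr0 // exprS mupM // IHk mulSn.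
suff [-> //] : mup a (\prod_i B i ^+ m i) = (\sum_i m i * mup a (B i))%N
  /\ \prod_i B i ^+ m i != 0.
elim/big_rec2: _ => [|i k q _ [<- qnz]]; first by rewrite mup1 oner_neq0.
by rewrite mupM // mupX mulf_neq0.
Qed.

Lemma cbtrunc_coef0 (R : comNzRingType) h r : (cbtrunc R h r).[0] = 1.
Proof. by rewrite horner_coef0 coef_poly /= /cbin double0 bin0 exp1n. Qed.

(** Artin's argument gives two monomials for which the quotient of the B's is a (p - 1)-st power.
    Each root of A_r has multiplicity below r, so the weight bound keeps the multiplicities in both
    B's below p - 1 and the B's coincide. *)
Lemma cbmono_dependence_pchar (K : closedFieldType) (h n : nat) (r : 'I_n -> nat)
    (I : finType) (m : I -> 'I_n -> nat) (c : I -> {poly K}) :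
  let p := h.*2.+1 in p \in [pchar K] -> (forall k, 2 <= r k)%N ->
  (forall i, \sum_k m i k * r k < p.-1)%N -> (exists i, c i != 0) ->
  \sum_i fps_of_poly (c i) * cbmono K r (m i) = 0 ->
  exists i j, i != j /\
    forall l, (l < p)%N -> cbmono K r (m i) l = cbmono K r (m j) l.
Proof.
move=> p charp r2 mp cnz rel.
have r0 k : (0 < r k)%N by rewrite ltnW.
have charL : p \in [pchar (fps K)].
  rewrite inE (pcharf_prime charp) /=; apply/eqP/fpsP => l.
  have := pcharf0 charp; rewrite -[p%:R : fps K](rmorph_nat (@fps_of_poly K)) /=.
  by rewrite -polyC_natr coefC => ->; case: ifP.
have [i [j [c1 [c2 [ij c1nz c2nz E]]]]] := frobenius_dependence
  (@fps_of_poly_inj K) charL (fun i => cbmono_frobenius (m i) charp r0)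
  (fun i => cbmono_neq0 K r (m i)) cnz rel.
exists i, j; split=> // l lp; rewrite !(cbmono_coef_trunc _ charp r0) //.
have tnz k : cbtrunc K h (r k) != 0.
  by apply: contra_eq_neq (cbtrunc_coef0 K h (r k)) => ->; rewrite horner0 eq_sym oner_neq0.
have B0 e : (cbmono_trunc K h r e).[0] = 1.
  rewrite horner_prod big1 // => k _; by rewrite horner_exp cbtrunc_coef0 expr1n.
have mB i' a : (mup a (cbmono_trunc K h r (m i')) < p.-1)%N.
  rewrite mup_prod_exp //; apply: leq_ltn_trans (mp i'); apply: leq_sum => k _.
  apply: leq_mul => //; apply: ltnW; apply: (hypergeometric_root_mult _ charp) => //.
  - have : (size (cbtrunc K h (r k)) <= h.+1)%N by exact: size_poly.
    by rewrite /p; move: (size _) => s; lia.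
  - by rewrite cbtrunc_coef0 oner_neq0.
  - exact: cbtrunc_ode.
by rewrite (eq_of_small_mup c1nz c2nz (B0 _) (B0 _) (mB i) (mB j) E).
Qed.

(** * Growth of coefficients *)

Lemma leq_wexp2r k m n : (m <= n)%N -> (m ^ k <= n ^ k)%N.
Proof. by case: k => // k; rewrite leq_exp2r. Qed.

Lemma cbin_le n : (cbin n <= 4 ^ n)%N.
Proof.
elim: n => [|n IHn]; first by rewrite /cbin bin0.
have := cbinS n; rewrite expnS; nia.
Qed.

Lemma cbin_ge n : (4 ^ n <= n.*2.+1 * cbin n)%N.
Proof.
elim: n => [|n IHn]; first by rewrite /cbin bin0.
have := cbinS n; rewrite expnS doubleS; nia.
Qed.

Lemma exp4_beats_poly (C : nat) : exists n, (n.*2.+1 ^ C < 4 ^ n)%N.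
Proof.
(* Taking n to be a power of 2 reduces the claim to (2j + 2) C < 2 * 2^(2j), which follows from j <
   2^j. *)
pose j := C.*2.+2; exists (2 ^ j.*2)%N.
have e : ((2 ^ j.*2).*2.+1 <= 2 ^ j.*2.+2)%N.
  by rewrite 2!expnS; have := expn_gt0 2 j.*2; lia.
apply: leq_ltn_trans (_ : (2 ^ j.*2.+2) ^ C < _)%N; first exact: leq_wexp2r.
rewrite -[4%N]/(2 ^ 2)%N -!expnM ltn_exp2l //.
have jlt : (j < 2 ^ j)%N by exact: ltn_expl.
rewrite -addnn expnD.
have : (j * j <= 2 ^ j * 2 ^ j)%N by rewrite leq_mul // ltnW.
by rewrite /j; nia.
Qed.

(** Growth like M^n up to a polynomial factor; nonnegativity is included so that bounds can be
    multiplied termwise. *)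
Definition exp_bounded (M : nat) (f : fps int) : Prop :=
  exists B, forall n, 0 <= f n <= (n.+1 ^ B * M ^ n)%N%:R.

Lemma exp_bounded1 M : (0 < M)%N -> exp_bounded M 1.
Proof.
move=> M0; exists 0%N => n; rewrite fps_coef1 mul1n ler_nat ler0n /=.
by case: eqP => // ->.
Qed.

Lemma exp_boundedM M f g : exp_bounded M f -> exp_bounded M g -> exp_bounded M (f * g).
Proof.
(* The extra 1 in the exponent accounts for the n + 1 terms of the convolution. *)
move=> [B fB] [C gC]; exists (B + C).+1 => n; rewrite fps_coefM; apply/andP; split.
  by apply: sumr_ge0 => i _; rewrite mulr_ge0 //; [case/andP: (fB i)|case/andP: (gC (n - i)%N)].
apply: le_trans (_ : \sum_(i < n.+1) (n.+1 ^ (B + C) * M ^ n)%N%:R <= _); last first.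
  by rewrite sumr_const card_ord -mulrnA mulnC mulnA -expnS.
apply: ler_sum => i _; have [f0 fi] := andP (fB i); have [g0 gi] := andP (gC (n - i)%N).
apply: le_trans (ler_pM f0 g0 fi gi) _; rewrite -natrM ler_nat.
have lein : (i <= n)%N by rewrite -ltnS.
rewrite mulnACA -[(M ^ i * _)%N]expnD subnKC // leq_mul2r expnD.
by rewrite leq_mul ?orbT // leq_wexp2r // ltnS leq_subr.
Qed.

Lemma exp_bounded_exp M f k : (0 < M)%N -> exp_bounded M f -> exp_bounded M (f ^+ k).
Proof.
move=> M0 fM; elim: k => [|k IHk]; first exact: exp_bounded1.
by rewrite exprS; apply: exp_boundedM.
Qed.

Lemma cbseries_exp_bounded (M r : nat) : (4 ^ r <= M)%N -> exp_bounded M (cbseries int r).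
Proof.
move=> rM; exists 0%N => n; rewrite mul1n ler0n ler_nat /=.
apply: leq_trans (leq_wexp2r r (cbin_le n)) _.
by rewrite expnAC leq_wexp2r.
Qed.

(** By positivity and [f 0 = 1], the coefficient of z^n on the left is at least u_n^(s+1) >= (4^n /
    (2n + 1))^(s+1), which for some n exceeds (n + 1)^B 4^(s n). *)
Lemma cbseries_not_dominated (s : nat) (f g : fps int) :
  (forall n, 0 <= f n) -> f 0%N = 1 -> exp_bounded (4 ^ s) g ->
  cbseries int s.+1 * f <> g.
Proof.
move=> f0 f1 [B gB] fg; have [n ltn4] := exp4_beats_poly (s.+1 + B).
have := gB n; rewrite -fg fps_coefM => /andP[_]; apply/negP; rewrite -ltNge.
apply: lt_le_trans (_ : (cbin n ^ s.+1)%N%:R <= _); last first.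
  rewrite big_ord_recr /= subnn f1 mulr1 lerDr sumr_ge0 // => i _.
  by rewrite mulr_ge0 ?ler0n.
rewrite ltr_nat; have := leq_wexp2r s.+1 (cbin_ge n).
have pn : (0 < n.*2.+1 ^ s.+1)%N by rewrite expn_gt0.
rewrite expnMn -(ltn_pmul2l pn); apply: leq_trans.
rewrite [X in (_ < X)%N]expnS [((4 ^ n) ^ s)%N]expnAC mulnA ltn_pmul2r ?expn_gt0 //.
apply: leq_ltn_trans ltn4; rewrite expnD leq_mul2l leq_wexp2r ?orbT //.
by rewrite ltnS; lia.
Qed.

Lemma cbmonoD (R : comNzRingType) n (r m1 m2 : 'I_n -> nat) :
  cbmono R r (fun k => m1 k + m2 k)%N = cbmono R r m1 * cbmono R r m2.
Proof. by rewrite /cbmono -big_split; apply: eq_bigr => k _; rewrite exprD. Qed.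

Lemma cbmono_ge0 n (r m : 'I_n -> nat) l : 0 <= cbmono int r m l.
Proof.
have ge0M (f g : fps int) : (forall l, 0 <= f l) -> (forall l, 0 <= g l) ->
    forall l, 0 <= (f * g) l.
  by move=> f0 g0 l'; rewrite fps_coefM sumr_ge0 // => i _; rewrite mulr_ge0.
have ge01 l' : 0 <= (1 : fps int) l' by rewrite fps_coef1 ler0n.
rewrite /cbmono; move: l; elim/big_rec: _ => [//|k f _ f0]; apply: (ge0M) => //.
by elim: (m k) => [//|i IHi]; rewrite exprS; apply: (ge0M) => // l'; rewrite ler0n.
Qed.

(* Cancel the common factors and isolate one factor cbseries (r k), where r k is
   the largest index at which m1 and m2 differ. *)
Lemma cbmono_inj n (r m1 m2 : 'I_n -> nat) : injective r -> (forall k, 0 < r k)%N ->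
  cbmono int r m1 = cbmono int r m2 -> m1 =1 m2.
Proof.
move=> r_inj r0 E k1; apply/eqP; apply: contraT => k1P.
case: (@arg_maxnP _ k1 (fun k => m1 k != m2 k) r k1P) => k kP kmax {k1 k1P}.
wlog lt21 : m1 m2 E kP kmax / (m2 k < m1 k)%N => [wl|].
  move: (kP); rewrite neq_ltn => /orP[lt12|]; last exact: wl.
  by apply: (wl m2 m1) => //; [rewrite eq_sym|move=> j; rewrite eq_sym; exact: kmax].
pose c j := minn (m1 j) (m2 j).
have splitE (m : 'I_n -> nat) : (forall j, c j <= m j)%N ->
    cbmono int r m = cbmono int r c * cbmono int r (fun j => m j - c j)%N.
  move=> cm; rewrite -cbmonoD; congr cbmono; apply: funext => j.
  by rewrite subnKC.
have E' : cbmono int r (fun j => m1 j - c j)%N = cbmono int r (fun j => m2 j - c j)%N.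
  apply: (mulfI (cbmono_neq0 int r c)).
  by rewrite -!splitE // => j; rewrite ?geq_minl ?geq_minr.
pose e j := if j == k then (m1 k - c k).-1 else (m1 j - c j)%N.
have m1E : cbmono int r (fun j => m1 j - c j)%N = cbseries int (r k) * cbmono int r e.
  rewrite /cbmono (bigD1 k) //= [in RHS](bigD1 k) //= {1}/e eqxx mulrA -exprS.
  rewrite prednK; last by rewrite /c; lia.
  by congr (_ * _); apply: eq_bigr => j /negPf jk; rewrite /e jk.
rewrite m1E -(prednK (r0 k)) in E'.
case: (cbseries_not_dominated (cbmono_ge0 r e) (cbmono_coef0 int r e) _ E').
rewrite /cbmono; elim/big_rec: _ => [|j f _ fB]; first by apply: exp_bounded1; rewrite expn_gt0.
apply: exp_boundedM => //.
(* No index j with r j >= r k is left on the right: at k because m2 k < m1 k, elsewhere by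
   maximality of r k and injectivity of r. *)
have [rjk|rkj] := leqP (r k) (r j).
  suff -> : (m2 j - c j)%N = 0%N by apply: exp_bounded1; rewrite expn_gt0.
  have [->|jk] := eqVneq j k; first by rewrite /c; lia.
  rewrite /c; have [->|/kmax] := eqVneq (m1 j) (m2 j); first by rewrite minnn subnn.
  move=> rj; have /eqP := jk; case; apply: r_inj; apply/eqP; by rewrite eqn_leq rjk andbT.
apply: exp_bounded_exp; first by rewrite expn_gt0.
apply: cbseries_exp_bounded; rewrite leq_pexp2l //.
by rewrite -ltnS prednK.
Qed.

(** * From C to Z, and from Z to characteristic p *)

Lemma fps_coef_sum (R : comNzRingType) (J : finType) (g : J -> fps R) l :
  (\sum_j g j) l = \sum_j (g j) l.
Proof. by elim/big_rec2: _ => // j x y _ <-. Qed.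

Section FpsMap.
Variables (R S : comNzRingType) (phi : {rmorphism R -> S}).

Definition fps_map (f : fps R) : fps S := Fps (fun n => phi (f n)).

Fact fps_map_is_zmod_morphism : zmod_morphism fps_map.
Proof. by move=> f g; apply/fpsP => n /=; rewrite rmorphB. Qed.
Fact fps_map_is_monoid_morphism : monoid_morphism fps_map.
Proof.
split=> [|f g]; apply/fpsP => n /=; first by rewrite rmorph_nat.
by rewrite rmorph_sum; apply: eq_bigr => i _; rewrite rmorphM.
Qed.

HB.instance Definition _ := GRing.isZmodMorphism.Build (fps R) (fps S)
  fps_map fps_map_is_zmod_morphism.
HB.instance Definition _ := GRing.isMonoidMorphism.Build (fps R) (fps S)
  fps_map fps_map_is_monoid_morphism.

Lemma fps_map_poly (q : {poly R}) : fps_map (fps_of_poly q) = fps_of_poly (map_poly phi q).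
Proof. by apply/fpsP => n /=; rewrite coef_map. Qed.

Lemma fps_map_cbmono n (r m : 'I_n -> nat) : fps_map (cbmono R r m) = cbmono S r m.
Proof.
rewrite /cbmono rmorph_prod; apply: eq_bigr => k _; rewrite rmorphXn; congr (_ ^+ _).
by apply/fpsP => l /=; rewrite rmorph_nat.
Qed.

End FpsMap.

Lemma intr_eq0_pchar (R : nzRingType) (p : nat) (z : int) :
  p \in [pchar R] -> (z%:~R == 0 :> R) = (p %| `|z|)%N.
Proof.
move=> charp; rewrite (dvdn_pcharf charp); case: z => k //=.
by rewrite NegzE mulrNz oppr_eq0.
Qed.

(** The unknowns are the coefficients of the [c i], with one equation for each power z^l; the
    equations have coefficients in [D], so [lin_dep_descent] applies. *)
Lemma fps_dependence_descent (D L : idomainType) (phi : {rmorphism D -> L})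
    (I : finType) (F : I -> fps D) (c : I -> {poly L}) :
  injective phi -> (exists i, c i != 0) ->
  \sum_i fps_of_poly (c i) * fps_map phi (F i) = 0 ->
  exists2 d : I -> {poly D}, (exists i, d i != 0) & \sum_i fps_of_poly (d i) * F i = 0.
Proof.
move=> phi_inj [i0 ci0] rel.
pose N := \max_i size (c i).
have cN i : (size (c i) <= N)%N by exact: leq_bigmax.
have polyE (A : comNzRingType) (e : nat -> A) (f : fps A) l :
    (fps_of_poly (\poly_(t < N) e t) * f) l = \sum_(t < N) e t * (fps_of_poly 'X^t * f) l.
  rewrite poly_def rmorph_sum mulr_suml /=.
  rewrite fps_coef_sum; apply: eq_bigr => t _.
  rewrite !fps_coefM mulr_sumr; apply: eq_bigr => j _.
  by rewrite /= coefZ mulrA.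
pose v (x : I * 'I_N) l := (fps_of_poly 'X^(x.2) * F x.1) l.
have [|l|d [[i1 t1] _ d1] dv] := @lin_dep_descent D L phi (I * 'I_N)%type
  (index_enum _) v (fun x => (c x.1)`_x.2) phi_inj (index_enum_uniq _).
- have ltN : ((size (c i0)).-1 < N)%N.
    by apply: leq_trans (cN i0); rewrite prednK // size_poly_gt0.
  exists (i0, Ordinal ltN); first exact: mem_index_enum.
  by rewrite /= -lead_coefE lead_coef_eq0.
- move/fpsP/(_ l): rel; rewrite fps_coef_sum fps_coef0 => rel; rewrite -[RHS]rel.
  rewrite -(pair_bigA _ (fun i (t : 'I_N) => (c i)`_t * phi (v (i, t) l))).
  apply: eq_bigr => i _.
  have cE : c i = \poly_(t < N) (c i)`_t.
    apply/polyP => t; rewrite coef_poly; case: ltnP => // Nt.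
    by rewrite nth_default // (leq_trans (cN i)).
  rewrite [in RHS]cE polyE; apply: eq_bigr => t _; congr (_ * _).
  rewrite /v -[LHS]/(fps_map phi (fps_of_poly 'X^t * F i) l) rmorphM.
  by rewrite -(map_polyXn phi) -fps_map_poly.
(* [insub] makes t an ordinal; the default 0 is never reached, as t < N. *)
exists (fun i => \poly_(t < N) (if insub t is Some t' then d (i, t') else 0)).
  exists i1; apply: contraNneq d1 => /polyP/(_ t1).
  by rewrite coef_poly ltn_ord valK coef0 => ->.
apply/fpsP => l; rewrite fps_coef_sum fps_coef0 -[RHS](dv l).
transitivity (\sum_i \sum_(t < N) d (i, t) * v (i, t) l); last first.
  by rewrite pair_big; apply: eq_bigr => -[].
by apply: eq_bigr => i _; rewrite polyE; apply: eq_bigr => t _; rewrite valK.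
Qed.

Lemma cbmono_independent (L : idomainType) (n : nat) (r : 'I_n -> nat)
    (I : finType) (m : I -> 'I_n -> nat) (c : I -> {poly L}) :
  [pchar L] =i pred0 -> injective r -> (forall k, 2 <= r k)%N ->
  (forall i j, m i =1 m j -> i = j) ->
  \sum_i fps_of_poly (c i) * cbmono L r (m i) = 0 -> forall i, c i = 0.
Proof.
move=> char0 r_inj r2 m_inj rel i0; apply/eqP; apply: contraT => ci0; exfalso.
have r0 k : (0 < r k)%N by rewrite ltnW.
have intr_inj : injective (intr : int -> L).
  move=> x y /eqP; rewrite -subr_eq0 -rmorphB /= => xy; apply/eqP; rewrite -subr_eq0.
  have nat0 k : (k%:R == 0 :> L) = (k == 0)%N by move/pcharf0P: char0 => ->.
  by case: (x - y) xy => k; rewrite ?NegzE ?mulrNz ?oppr_eq0 nat0.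
have [||d [i1 di1] drel] := @fps_dependence_descent int L intr I
  (fun i => cbmono int r (m i)) c intr_inj; first by exists i0.
  by under eq_bigr do rewrite fps_map_cbmono.
(* N bounds both a degree l at which two distinct monomials differ over Z and the size of their
   difference z there, so a prime above N still separates them. *)
have b_ex (x : I * I) : exists N, x.1 != x.2 -> exists2 l, (l <= N)%N &
    exists2 z : int, z != 0 & (`|z| <= N)%N /\
      z = cbmono int r (m x.1) l - cbmono int r (m x.2) l.
  case: x => i j /=; have [_|ij] := eqVneq i j; first by exists 0%N.
  have /existsNP[l lP] : ~ forall l, cbmono int r (m i) l = cbmono int r (m j) l.
    by move=> /fpsP/(cbmono_inj r_inj r0)/m_inj/eqP; rewrite (negPf ij).
  pose z := cbmono int r (m i) l - cbmono int r (m j) l.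
  exists (maxn l `|z|) => _; exists l; first exact: leq_maxl.
  by exists z; [rewrite subr_eq0; apply/eqP|split; [exact: leq_maxr|]].
have [b bP] := choice b_ex.
pose a := lead_coef (d i1).
pose w i := (\sum_k m i k * r k)%N.
(* The 2 makes p odd and, with [w], puts the weights below p - 1; [a] keeps the relation nonzero
   modulo p; [b] keeps distinct monomials apart. *)
pose bound := (2 + `|a| + \max_i w i + \max_x b x)%N.
have [p pbig pp] := prime_above bound.
have a0 : a != 0 by rewrite lead_coef_eq0.
have [K [FtoK _]] := countable_algebraic_closure 'F_p.
have charp : p \in [pchar K] by rewrite (fmorph_pchar FtoK) pchar_Fp.
pose h := p./2.
have pE : p = h.*2.+1.
  by rewrite /h -[LHS]odd_double_half (_ : odd p) ?add1n //; case/even_prime: pp => // p2;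
     move: pbig; rewrite p2 /bound; lia.
have wm i : (\sum_k m i k * r k <= \max_i w i)%N by exact: (leq_bigmax (F := w) i).
have small_neq0 (z : int) : z != 0 -> (`|z| < p)%N -> z%:~R != 0 :> K.
  by move=> z0 zp; rewrite (intr_eq0_pchar _ charp) gtnNdvd ?absz_gt0.
have aK : a%:~R != 0 :> K by apply: small_neq0 => //; move: pbig; rewrite /bound; lia.
rewrite pE in charp.
have [|||i [j [ij eq_ij]]] := @cbmono_dependence_pchar K h n r I m
    (fun i => map_poly intr (d i)) charp r2.
- by move=> i; rewrite -pE; have := wm i; move: pbig; rewrite /bound; lia.
- by exists i1; rewrite -lead_coef_eq0 lead_coef_map_id0.
- move/(congr1 (fps_map (intr : int -> K))): drel; rewrite rmorph_sum rmorph0 => drel.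
  rewrite -[RHS]drel; apply: eq_bigr => i _; rewrite rmorphM.
  by rewrite -fps_map_poly -(fps_map_cbmono (intr : {rmorphism int -> K})).
have [l lb [z z0 [zb zE]]] := bP (i, j) ij.
have bp : (b (i, j) < p)%N.
  by have := leq_bigmax (F := b) (i, j); move: pbig; rewrite /bound; lia.
have /eqP := small_neq0 z z0 (leq_ltn_trans zb bp); apply.
rewrite zE rmorphB /=; apply/eqP; rewrite subr_eq0; apply/eqP.
have := eq_ij l; rewrite -pE => /(_ (leq_ltn_trans lb bp)).
by rewrite -!(fps_map_cbmono (intr : {rmorphism int -> K})).
Qed.

Theorem theorem6p6 (R : realType) :
  @alg_independent (ratfun R[i]) (laurent R[i]) (@laurent_of_ratfun R[i])
    {r : nat | (2 <= r)%N}
    (fun r => (central_binomial_series R[i] (sval r))%:F).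
Proof.
move=> n i i_inj P P0; set C := R[i] in P P0 *.
pose r k := sval (i k).
have r_inj : injective r by move=> k l /val_inj/i_inj.
have r2 k : (2 <= r k)%N by exact: (svalP (i k)).
have char0 : [pchar C] =i pred0 by exact: pchar_num.
pose N := size (msupp P).
pose m (j : 'I_N) : 'X_{1..n} := tnth (in_tuple (msupp P)) j.
have m_inj j j' : m j =1 m j' -> j = j'.
  by move=> /mnmP; exact: (elimT (tuple_uniqP (in_tuple (msupp P))) (msupp_uniq P)).
pose num j := (repr P@_(m j)).1; pose den j := (repr P@_(m j)).2.
have den0 j : den j != 0 by exact: denom_ratioP.
have num0 j : num j != 0.
  have : m j \in msupp P by exact: mem_tnth.
  rewrite mcoeff_msupp; apply: contraNneq => numj0.
  by rewrite [P@_(m j)]frac_repr -/(num j) numj0 tofrac0 mul0r.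
(* The coefficient of the j-th monomial of [P], multiplied by the product of all denominators. *)
pose c j := num j * \prod_(j' | j' != j) den j'.
have cnz j : c j != 0 by rewrite mulf_neq0 //; apply/prodf_neq0.
(* All [c j] are nonzero, so their vanishing leaves only an empty support. *)
suff c0 j : c j = 0.
  apply/eqP; rewrite -msupp_eq0 -size_eq0; apply: contraT; rewrite -lt0n => N0.
  by have := cnz (Ordinal N0); rewrite c0 eqxx.
apply: (cbmono_independent char0 r_inj r2 m_inj) => {j}.
apply/eqP; rewrite -(tofrac_eq0 (R := fps C)); apply/eqP.
pose D := \prod_j (fps_of_poly (den j))%:F.
transitivity (D * mmap (@laurent_of_ratfun C)
   (fun k => (central_binomial_series C (sval (i k)))%:F) P); last by rewrite P0 mulr0.
rewrite rmorph_sum /mmap [in RHS]big_tnth mulr_sumr; apply: eq_bigr => j _.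
rewrite -/(m j).
(* [cbseries] over C and [central_binomial_series] are convertible. *)
have -> : mmap1 (fun k => (central_binomial_series C (sval (i k)))%:F) (m j) =
    (cbmono C r (m j))%:F.
  by rewrite /mmap1 /cbmono rmorph_prod; apply: eq_bigr => k _; rewrite rmorphXn.
rewrite /laurent_of_ratfun -/(num j) -/(den j) rmorphM mulrA; congr (_ * _).
have denF0 : (fps_of_poly (den j))%:F != 0.
  by rewrite tofrac_eq0 -(rmorph0 (@fps_of_poly C)) (inj_eq (@fps_of_poly_inj C)).
rewrite /D (bigD1 j) //= [RHS]mulrC -mulrA mulKf // /c rmorphM rmorph_prod.
by rewrite tofracM; congr (_ * _); rewrite rmorph_prod.
Qed.
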